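(* There exists an infinitely edge-connected graph that contains neither the Farey graph nor $T_{\aleph_0} * t$ as a topological minor.
   Context: Graphs are simple and may be infinite. A graph is infinitely edge-connected if no two distinct vertices can be separated by deleting finitely many edges. A graph $H$ is a topological minor of $G$ if $G$ contains a subdivision of $H$ as a subgraph. The Farey graph is the graph on $\mathbb{Q}\cup\{\infty\}$ in which $a/b$ and $c/d$ in lowest terms (with $\infty=(\pm1)/0$) are adjacent iff $ad-bc=\pm1$. $T_{\aleph_0}$ is the tree in which every vertex has countably infinite degree, and $T_{\aleph_0}*t$ is obtained from it by adding a new vertex $t$ adjacent to all its vertices. *)

(* Defs.v *)
(* Simple graphs, possibly infinite: a vertex type with decidable
   equality and a boolean adjacency relation; in the presence of classical
   choice this is no restriction. *)
From HB Require Import structures.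
From mathcomp Require Import all_boot all_order all_algebra.
From mathcomp Require Import zify.

Set Implicit Arguments.
Unset Strict Implicit.
Unset Printing Implicit Defensive.

Import Order.TTheory GRing.Theory Num.Theory.

Record sgraph := SGraph {
  vertex :> eqType;
  adj : rel vertex;
  adj_sym : symmetric adj;
  adj_irr : irreflexive adj
}.

Definition joined (V : eqType) (e : rel V) (x y : V) : Prop :=
  exists2 p : seq V, path e x p & last x p = y.

(* An edge {x, y} is listed in F as (x, y) or as (y, x); pairs in F that are
   not edges have no effect. *)
Definition del_edges (G : sgraph) (F : seq (G * G)) : rel G :=
  fun x y => [&& adj x y, (x, y) \notin F & (y, x) \notin F].

(* As usual for edge-connectivity, a graph with at most one vertex does not
   count; otherwise such graphs would qualify vacuously. *)
Definition infinitely_edge_connected (G : sgraph) : Prop :=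
  (exists x y : G, x != y) /\
  forall x y : G, x != y ->
    forall F : seq (G * G), joined (del_edges F) x y.

(* G contains (an isomorphic copy of) S as a not necessarily induced
   subgraph. *)
Definition contains_subgraph (G S : sgraph) : Prop :=
  exists f : S -> G, injective f /\ {homo f : x y / adj x y}.

(* S arises from H by replacing each edge uv with a path from f u to f v
   whose sequence of inner vertices is P u v.  Both orientations of an edge
   are given the same path. *)
Record is_subdivision_via (H S : sgraph) (f : H -> S) (P : H -> H -> seq S) :
    Prop := {
  branch_inj : injective f;
  subdiv_rev : forall u v, adj u v -> P v u = rev (P u v);
  subdiv_path : forall u v, adj u v -> path (@adj S) (f u) (rcons (P u v) (f v));
  subdiv_uniq : forall u v, adj u v -> uniq (P u v);
  subdiv_branch : forall u v w, adj u v -> f w \notin P u v;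
  subdiv_disj : forall u v u' v' x, adj u v -> adj u' v' ->
    x \in P u v -> x \in P u' v' -> (u', v') = (u, v) \/ (u', v') = (v, u);
  subdiv_vertex : forall x, (exists u, x = f u) \/
    (exists u v, adj u v /\ x \in P u v);
  subdiv_edge : forall x y, adj x y ->
    exists u v, adj u v /\ infix [:: x; y] (f u :: rcons (P u v) (f v))
}.

Definition is_subdivision (H S : sgraph) : Prop :=
  exists f P, @is_subdivision_via H S f P.

Definition topological_minor (H G : sgraph) : Prop :=
  exists S : sgraph, is_subdivision H S /\ contains_subgraph G S.

Section Farey.
Local Open Scope ring_scope.

(* [None] is the vertex infinity = 1/0; replacing 1/0 by (-1)/0 only changes
   the sign of the determinant. *)
Definition farey_num (x : option rat) : int := if x is Some q then numq q else 1.
Definition farey_den (x : option rat) : int := if x is Some q then denq q else 0.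

Definition farey_adj : rel (option rat) := fun x y =>
  let det := farey_num x * farey_den y - farey_den x * farey_num y in
  (det == 1) || (det == -1).

Lemma farey_adj_sym : symmetric farey_adj.
Proof. by move=> x y; rewrite /farey_adj; apply/idP/idP; lia. Qed.

Lemma farey_adj_irr : irreflexive farey_adj.
Proof. by move=> x; rewrite /farey_adj mulrC subrr. Qed.

Definition farey_graph : sgraph := SGraph farey_adj_sym farey_adj_irr.
End Farey.

Section Tree.
Definition connected_graph (G : sgraph) : Prop :=
  (exists x : G, true) /\ forall x y : G, joined (@adj G) x y.

Definition acyclic_graph (G : sgraph) : Prop :=
  forall c : seq G, 2 < size c -> uniq c -> ~~ cycle (@adj G) c.

Definition is_tree (G : sgraph) : Prop := connected_graph G /\ acyclic_graph G.

Definition countably_infinite_degree (G : sgraph) (x : G) : Prop :=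
  exists nb : nat -> G, injective nb /\ forall y, adj x y <-> exists n, y = nb n.

(* A concrete model of T_{aleph_0}: finite sequences of naturals, the children
   of s being the sequences n :: s.  Lemma [Taleph0_spec] checks that it is a
   tree all of whose vertices have countably infinite degree, which determines
   it up to isomorphism. *)
Definition is_child (s t : seq nat) : bool :=
  if t is _ :: u then u == s else false.

Definition Taleph0_adj : rel (seq nat) := fun s t => is_child s t || is_child t s.

Lemma Taleph0_adj_sym : symmetric Taleph0_adj.
Proof. by move=> s t; rewrite /Taleph0_adj orbC. Qed.

Lemma is_child_size s t : is_child s t -> size t = (size s).+1.
Proof. by case: t => //= n u /eqP ->. Qed.

Lemma Taleph0_adj_irr : irreflexive Taleph0_adj.
Proof.
move=> s; rewrite /Taleph0_adj orbb; apply/negP => /is_child_size; lia.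
Qed.

Definition Taleph0 : sgraph := SGraph Taleph0_adj_sym Taleph0_adj_irr.

Lemma Taleph0_max_nb (x y : seq nat) :
  Taleph0_adj x y -> size y <= size x -> y = behead x.
Proof.
case/orP; first by move/is_child_size => ->; rewrite ltnn.
by case: x => //= n u /eqP ->.
Qed.

Lemma Taleph0_acyclic : acyclic_graph Taleph0.
Proof.
move=> c sc uc; apply/negP => cc.
have [x xc xmax] : exists2 x : seq nat, x \in (c : seq (seq nat)) &
    forall y : seq nat, y \in (c : seq (seq nat)) -> size y <= size x.
  case: c sc {uc cc} => // a c _.
  elim: c a => [|b c IH] a.
    by exists a => [|y]; rewrite inE // => /eqP ->.
  have [x xc xmax] := IH b.
  case: (leqP (size x) (size a)) => h.
    exists a; first by rewrite mem_head.
    move=> y; rewrite inE => /predU1P[->//|/xmax hy].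
    exact: leq_trans hy h.
  exists x; first by rewrite inE xc orbT.
  by move=> y; rewrite inE => /predU1P[->|/xmax //]; exact: ltnW.
have [i c' ec] := rot_to xc.
have memc y : y \in x :: c' -> y \in (c : seq (seq nat)) by rewrite -ec mem_rot.
move: cc uc sc; rewrite -(rot_cycle i) -(rot_uniq i) -(size_rot i) ec.
case: c' memc {ec} => // y c'; case/lastP: c' => // c' z memc /=.
rewrite rcons_path last_rcons => /andP[xy /andP[_ zx]] /and3P[_ yn _] _.
have Ey : y = behead x.
  by apply: Taleph0_max_nb xy _; apply/xmax/memc; rewrite !inE eqxx orbT.
have Ez : z = behead x.
  apply: Taleph0_max_nb; first by rewrite Taleph0_adj_sym.
  by apply/xmax/memc; rewrite !inE mem_rcons mem_head !orbT.
by rewrite Ey -Ez mem_rcons mem_head in yn.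
Qed.

Lemma joined_trans (V : eqType) (e : rel V) x y z :
  joined e x y -> joined e y z -> joined e x z.
Proof.
move=> [p pp <-] [q qq <-]; exists (p ++ q); last by rewrite last_cat.
by rewrite cat_path pp.
Qed.

Lemma Taleph0_connected : connected_graph Taleph0.
Proof.
split; first by exists [::].
have root (s : Taleph0) : joined (@adj Taleph0) s [::] /\ joined (@adj Taleph0) [::] s.
  elim: s => [|n s [h1 h2]]; first by split; exists [::].
  split.
    apply: joined_trans h1; exists [:: s] => //=.
    by rewrite /Taleph0_adj /is_child eqxx orbT.
  apply: (joined_trans h2); exists [:: n :: s] => //=.
  by rewrite /Taleph0_adj /is_child eqxx.
move=> x y; exact: joined_trans (root x).1 (root y).2.
Qed.

Lemma Taleph0_degree (x : Taleph0) : countably_infinite_degree x.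
Proof.
case: x => [|m x].
  exists (fun n => [:: n]); split=> [a b [] //|y]; split=> [|[n ->]] //.
  by case/orP => //; case: y => //= n y /eqP ->; exists n.
exists (fun n => if n is n'.+1 then [:: n', m & x] else x); split.
  move=> [|a] [|b] //; last by case=> ->.
    by move/(congr1 size) => /=; lia.
  by move/(congr1 size) => /=; lia.
move=> y; split=> [/orP[|/eqP ->]|[[|n] ->]].
- by case: y => //= n y /eqP ->; exists n.+1.
- by exists 0.
- by rewrite /= /Taleph0_adj /= eqxx orbT.
- by rewrite /= /Taleph0_adj /= eqxx.
Qed.

Lemma Taleph0_spec :
  is_tree Taleph0 /\ forall x : Taleph0, countably_infinite_degree x.
Proof.
by split; [split; [exact: Taleph0_connected|exact: Taleph0_acyclic]|exact: Taleph0_degree].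
Qed.
End Tree.

Section Cone.
Variable G : sgraph.

Definition cone_adj : rel (option G) := fun x y =>
  match x, y with
  | Some u, Some v => adj u v
  | None, None => false
  | _, _ => true
  end.

Lemma cone_adj_sym : symmetric cone_adj.
Proof. by move=> [u|] [v|] //=; exact: adj_sym. Qed.

Lemma cone_adj_irr : irreflexive cone_adj.
Proof. by move=> [u|] //=; exact: adj_irr. Qed.

(* G * t; the new vertex t is [None]. *)
Definition cone : sgraph := SGraph cone_adj_sym cone_adj_irr.
End Cone.

(* Main.v *)
Require Import Defs.
From mathcomp Require Import all_boot.
From mathcomp Require Import all_order all_algebra.
From mathcomp Require Import zify ring lra.

(** The graph has vertex set the rationals, and for every n >= 2 the edges
   between k/n! and (k+1)/n!.  It is infinitely edge-connected because any two
   rationals are joined by a path using only edges of length 1/n!, for every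
   large enough n.  Two edges never cross as intervals of the line, so the graph
   is "outerplanar": it contains no three internally disjoint paths of length at
   least two with the same ends.  This excludes the cone over the tree, which
   contains K_{2,3}.  In the Farey graph every edge has two common neighbours, so
   in a subdivision contained in the graph no edge of the triangle 0, 1, infinity
   is properly subdivided; but the graph has no triangles, because 1/n! is never
   a sum 1/a! + 1/b! with a, b >= 2. *)

Set Implicit Arguments.
Unset Strict Implicit.
Unset Printing Implicit Defensive.

Import Order.TTheory GRing.Theory Num.Theory.
Local Open Scope ring_scope.

(** * The graph and its nested grids *)

Section FactorialGraph.

(* Starting at 2! makes consecutive denominators differ by a factor >= 3. *)
Definition level (n : nat) : rat := (n.+2)`!%:R.

Definition fact_edge (n : nat) (x y : rat) : bool :=
  (x * level n \is a Num.int) && (`|x - y| * level n == 1).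

(* The bound on n is harmless: the truncated quantity is (n+2)! > n on an edge
   of level n. *)
Definition fact_adj : rel rat :=
  fun x y => [exists n : 'I_(Num.truncn `|x - y|^-1), fact_edge n x y].

Lemma level_gt0 n : 0 < level n.
Proof. by rewrite /level ltr0n fact_gt0. Qed.

Lemma fact_adjP x y : reflect (exists n, fact_edge n x y) (fact_adj x y).
Proof.
apply: (iffP existsP) => [[n e]|[n e]]; first by exists n.
have /andP[_ /eqP e1] := e.
have ltn : (n < Num.truncn (`|x - y|^-1)%R)%N.
  have L0 := level_gt0 n.
  have -> : `|x - y|^-1 = level n.
    have d0 : `|x - y| != 0 by apply: contra_eq_neq e1 => ->; rewrite mul0r eq_sym oner_eq0.
    by apply: (mulfI d0); rewrite e1 divff.
  by rewrite /level natrK (leq_trans _ (fact_geq _)).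
by exists (Ordinal ltn).
Qed.

(** Integrality is asked of the first end only; it passes to the other because the scaled ends
    differ by 1 or -1. *)
Lemma fact_edge_sym n x y : fact_edge n x y -> fact_edge n y x.
Proof.
rewrite /fact_edge distrC => /andP[xi /[dup] /eqP e ->]; rewrite andbT.
have -> : y * level n = x * level n + (y - x) * level n by ring.
rewrite rpredD //; have L0 := level_gt0 n.
have: `|(y - x) * level n| = 1 by rewrite normrM (gtr0_norm L0).
by case: ger0P => _ => [->|/eqP]; rewrite ?eqr_oppLR ?rpred1 // => /eqP->; rewrite rpredN.
Qed.

Lemma fact_adj_sym : symmetric fact_adj.
Proof.
move=> x y; by apply/fact_adjP/fact_adjP => -[n /fact_edge_sym e]; exists n.
Qed.

Lemma fact_adj_irr : irreflexive fact_adj.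
Proof.
move=> x; apply/negbTE/negP => /fact_adjP[n /andP[_]].
by rewrite subrr normr0 mul0r eq_sym oner_eq0.
Qed.

Definition fact_graph : sgraph := SGraph fact_adj_sym fact_adj_irr.

Lemma dvd_level n m : (n <= m)%N -> exists k : nat, level m = k%:R * level n.
Proof.
move=> nm; have le2 : (n.+2 <= m.+2)%N by [].
by eexists; rewrite /level (fact_split le2) mulnC natrM.
Qed.

Lemma int_level n m x :
  (n <= m)%N -> x * level n \is a Num.int -> x * level m \is a Num.int.
Proof.
move=> /dvd_level[k ->] xi.
by rewrite mulrCA rpredM // rpred_nat.
Qed.

Lemma rat_level x : exists n, x * level n \is a Num.int.
Proof.
(* A denominator [d] divides [(d+2)!]. *)
exists `|denq x|%N.
have /dvdnP[k ek] : (`|denq x| %| (`|denq x|.+2)`!)%N.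
  by rewrite dvdn_fact // absz_gt0 denq_neq0 /= leqW.
rewrite /level ek natrM mulrCA rpredM ?rpred_nat //.
by rewrite natr_absz (gtr0_norm (denq_gt0 x)) -numqE rpred_int_num.
Qed.

(** * Edges as non-crossing intervals *)

Lemma edge_no_between m c d a :
  fact_edge m c d -> a * level m \is a Num.int -> a != c -> a != d ->
  (c < a) = (d < a).
Proof.
(* Scaled by [level m], [c] and [d] become consecutive integers and [a] an integer different from
   both. *)
move=> e /intrP[i ei] ac ad; have L0 := level_gt0 m.
have /andP[/intrP[j ej] _] := e; have /andP[/intrP[k ek] /eqP] := fact_edge_sym e.
rewrite -{1}(gtr0_norm L0) -normrM mulrBl ek ej -intrB -intr_norm => /(@intr_inj _ _ 1) ejk.
rewrite -(ltr_pM2r L0 c) -(ltr_pM2r L0 d) ei ej ek !ltr_int.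
have: (i != j) by apply: contra_neq ac => ij; apply: (mulIf (lt0r_neq0 L0)); rewrite ei ej ij.
have: (i != k) by apply: contra_neq ad => ij; apply: (mulIf (lt0r_neq0 L0)); rewrite ei ek ij.
by lia.
Qed.

(** The ends of the coarser edge are points of the finer grid, so neither lies inside the finer
    edge. The exclusive or on each side tells whether [c], respectively [d], lies between [a] and
    [b]. *)
Lemma noncrossing a b c d : fact_adj a b -> fact_adj c d ->
  a != c -> a != d -> b != c -> b != d ->
  (a < c) (+) (b < c) = (a < d) (+) (b < d).
Proof.
move=> /fact_adjP[n eab] /fact_adjP[m ecd] ac ad bc bd.
have /andP[ai _] := eab; have /andP[bi _] := fact_edge_sym eab.
have /andP[ci _] := ecd; have /andP[di _] := fact_edge_sym ecd.
have [nm|/ltnW mn] := leqP n m; last first.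
  rewrite (edge_no_between eab (int_level mn ci)) 1?eq_sym //.
  by rewrite (edge_no_between eab (int_level mn di)) 1?eq_sym // !addbb.
have flip (z t : rat) : z != t -> (z < t) = ~~ (t < z) by case: (ltgtP z t).
rewrite (flip a c) // (flip b c) // (flip a d) // (flip b d) //.
rewrite (edge_no_between ecd (int_level nm ai)) //.
by rewrite (edge_no_between ecd (int_level nm bi)).
Qed.

(** By [noncrossing] at each step, a walk that avoids [a] and [b] never passes between the inside
    and the outside of their interval. *)
Lemma edge_separates a b c q : fact_adj a b -> path fact_adj c q ->
  a \notin c :: q -> b \notin c :: q ->
  (a < c) (+) (b < c) = (a < last c q) (+) (b < last c q).
Proof.
move=> ab; elim: q c => //= d q IH c /andP[cd dq].
rewrite !(inE, negb_or) => /and3P[ac ad aq] /and3P[bc bd bq].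
by rewrite (noncrossing ab cd) // IH // inE negb_or ?ad ?bd.
Qed.

(* With a, b the first inner vertices, non-crossing of x a with the rest of the
   other path (and conversely) determines a < b and b < a; that exactly one of
   them holds is the conclusion. *)
Lemma two_paths_parity (x y a b : rat) p q :
  path fact_adj x (rcons (a :: p) y) -> path fact_adj x (rcons (b :: q) y) ->
  x != y -> x \notin a :: p -> y \notin a :: p -> x \notin b :: q ->
  y \notin b :: q -> (forall z, z \in a :: p -> z \notin b :: q) ->
  (x < a) (+) (a < y) != (x < b) (+) (b < y).
Proof.
rewrite /= => /andP[xa pa] /andP[xb pb] xy xp yp xq yq dis.
have a_y : a != y by apply: contraNneq yp => <-; rewrite mem_head.
have b_y : b != y by apply: contraNneq yq => <-; rewrite mem_head.
have disC z : z \in b :: q -> z \notin a :: p by move=> zq; apply/negP => /dis; rewrite zq.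
have E1 : (a < b) (+) (x < b) = (a < y) (+) (x < y).
  have := @edge_separates a x b (rcons q y); rewrite last_rcons; apply=> //.
  - by rewrite fact_adj_sym.
  - by rewrite -rcons_cons mem_rcons inE negb_or a_y dis ?mem_head.
  - by rewrite -rcons_cons mem_rcons inE negb_or xy.
have E2 : (b < a) (+) (x < a) = (b < y) (+) (x < y).
  have := @edge_separates b x a (rcons p y); rewrite last_rcons; apply=> //.
  - by rewrite fact_adj_sym.
  - by rewrite -rcons_cons mem_rcons inE negb_or b_y disC ?mem_head.
  - by rewrite -rcons_cons mem_rcons inE negb_or xy.
have ab : a != b.
  by have := dis a (mem_head _ _); rewrite inE negb_or => /andP[].
by move: E1 E2; case: ltgtP ab => //= _ _; do 5!case: (_ < _).
Qed.

(** The boolean compared in [two_paths_parity] tells whether the first inner vertex lies outside the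
    interval between [x] and [y]; three paths would need three pairwise distinct booleans. *)
Lemma no_theta (x y : rat) p1 p2 p3 :
  x != y ->
  (forall p, p \in [:: p1; p2; p3] ->
     [/\ p != [::], path fact_adj x (rcons p y), x \notin p & y \notin p]) ->
  (forall z, z \in p1 -> z \notin p2) -> (forall z, z \in p1 -> z \notin p3) ->
  (forall z, z \in p2 -> z \notin p3) -> False.
Proof.
move=> xy H d12 d13 d23.
have [] := H p1; first by rewrite !inE eqxx.
have [] := H p2; first by rewrite !inE eqxx orbT.
have [] := H p3; first by rewrite !inE eqxx !orbT.
case: p1 p2 p3 d12 d13 d23 {H} => [|a p] [|b q] [|c r] // d12 d13 d23.
move=> _ pr xr yr _ pq xq yq _ pp xp yp.
have := two_paths_parity pp pq xy xp yp xq yq d12.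
have := two_paths_parity pp pr xy xp yp xr yr d13.
have := two_paths_parity pq pr xy xq yq xr yr d23.
by do 3!case: (_ (+) _).
Qed.

(** * Edge lengths and triangles *)

Lemma level_sum i j k : (level i)^-1 + (level j)^-1 != (level k)^-1.
Proof.
have mono n m : (n <= m)%N -> (level m)^-1 <= (level n)^-1.
  by move=> nm; rewrite lef_pV2 ?posrE ?level_gt0 // /level ler_nat leq_fact.
have small n : (level n.+1)^-1 * 3%:R <= (level n)^-1.
  have L0 := level_gt0 n.
  rewrite ler_pdivrMl ?level_gt0 // /level factS natrM -/(level n).
  by rewrite mulfK ?lt0r_neq0 // ler_nat.
have P n : 0 < (level n)^-1 by rewrite invr_gt0 level_gt0.
have := P i; have := P j; have := P k; have := small k.
(* If one summand is at least the right-hand side, the sum is too large; otherwise both are at most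
   a third of it, and the sum is too small. *)
have [/mono hi|/mono hi] := leqP i k; first by move=> *; apply/eqP; lra.
have [/mono hj|/mono hj] := leqP j k; first by move=> *; apply/eqP; lra.
by move=> *; apply/eqP; lra.
Qed.

(** Among three points of a line the largest distance is the sum of the other two; [level_sum] is
    used once for each candidate. *)
Lemma no_triangle (x y z : rat) :
  fact_adj x y -> fact_adj y z -> fact_adj x z -> False.
Proof.
have len n a b : fact_edge n a b -> `|a - b| = (level n)^-1.
  by move=> /andP[_ /eqP e]; rewrite -[LHS](mulfK (lt0r_neq0 (level_gt0 n))) e mul1r.
move=> /fact_adjP[i /len ei] /fact_adjP[j /len ej] /fact_adjP[k /len ek].
have := level_sum i j k; have := level_sum j k i; have := level_sum i k j.
rewrite -ei -ej -ek => /eqP h1 /eqP h2 /eqP h3.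
move: h1 h2 h3; case: (ger0P (x - y)); case: (ger0P (y - z)); case: (ger0P (x - z)) => *;
 lra.
Qed.

(** * Infinite edge-connectivity *)

Lemma level_joined n (F : seq (rat * rat)) x y :
  (forall e, e \in F -> ~~ fact_edge n e.1 e.2) ->
  x * level n \is a Num.int -> y * level n \is a Num.int ->
  joined (del_edges (G := fact_graph) F) x y.
Proof.
move=> nF xi yi; have L0 := level_gt0 n.
have edge u v : fact_edge n u v -> del_edges (G := fact_graph) F u v.
  move=> e; rewrite /del_edges; apply/and3P; split.
  - by apply/fact_adjP; exists n.
  - by apply/negP => /nF; rewrite e.
  - by apply/negP => /nF; rewrite /= fact_edge_sym.
(* Walks of [k] unit steps on the grid, in both directions since either of [x] and [y] may be the
   smaller. *)
have up (k : nat) u : u * level n \is a Num.int ->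
    joined (del_edges (G := fact_graph) F) u (u + k%:R / level n) /\
    joined (del_edges (G := fact_graph) F) (u + k%:R / level n) u.
  move=> ui; elim: k => [|k [IH1 IH2]].
    by rewrite mul0r addr0; split; exists [::].
  have e : fact_edge n (u + k%:R / level n) (u + k.+1%:R / level n).
    rewrite /fact_edge mulrDl mulfVK ?lt0r_neq0 // rpredD ?rpred_nat //=.
    have -> : u + k%:R / level n - (u + k.+1%:R / level n) = - (level n)^-1.
      by rewrite -natr1; ring.
    by rewrite normrN gtr0_norm ?invr_gt0 // mulVf ?lt0r_neq0.
  split.
    apply: (joined_trans IH1); exists [:: u + k.+1%:R / level n] => //=.
    by rewrite edge.
  apply: (joined_trans _ IH2); exists [:: u + k%:R / level n] => //=.
  by rewrite edge // fact_edge_sym.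
have /intrP[i ei] := xi; have /intrP[j ej] := yi.
have ex : x = i%:~R / level n by rewrite -ei mulfK ?lt0r_neq0.
have ey : y = j%:~R / level n by rewrite -ej mulfK ?lt0r_neq0.
have [ij|ji] := leP i j.
  have -> : y = x + `|j - i|%N%:R / level n.
    by rewrite natr_absz ger0_norm ?subr_ge0 // ex ey -mulrDl intrB addrC subrK.
  by case: (up `|j - i|%N x xi).
have -> : x = y + `|i - j|%N%:R / level n.
  by rewrite natr_absz ger0_norm ?subr_ge0 ?ltW // ex ey -mulrDl intrB addrC subrK.
by case: (up `|i - j|%N y yi).
Qed.

Lemma fact_graph_infinitely_edge_connected : infinitely_edge_connected fact_graph.
Proof.
split; first by exists (0 : rat), (1 : rat).
move=> x y _ F.
(* The length of an edge determines its level, so the finite list [F] meets only finitely many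
   levels. *)
have [N HN] : exists N, forall n, (N <= n)%N ->
    forall e, e \in F -> ~~ fact_edge n e.1 e.2.
  elim: F => [|[a b] F [N IH]]; first by exists 0%N.
  have [adjab|nadj] := boolP (fact_adj a b); last first.
    exists N => n Nn e; rewrite inE => /predU1P[->|/(IH n Nn)//].
    by apply: contra nadj => eab; apply/fact_adjP; exists n.
  have /fact_adjP[m /andP[_ /eqP em]] := adjab.
  exists (maxn N m.+1) => n; rewrite geq_max => /andP[Nn mn] e.
  rewrite inE => /predU1P[->|/(IH n Nn)//] /=.
  apply/negP => /andP[_ /eqP en].
  have d0 : `|a - b| != 0 by apply: contra_eq_neq em => ->; rewrite mul0r eq_sym oner_eq0.
  have /eqP := mulfI d0 (etrans em (esym en)).
  rewrite /level eqr_nat => /eqP.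
  have : (m.+2`! < n.+2`!)%N by rewrite ltn_fact // ltnS.
  by move=> /[swap] ->; rewrite ltnn.
have [n1 x1] := rat_level x; have [n2 y2] := rat_level y.
set n := maxn N (maxn n1 n2).
apply: (@level_joined n); first by apply: HN; rewrite leq_maxl.
  by apply: int_level x1; rewrite /n !leq_max leqnn !orbT.
by apply: int_level y2; rewrite /n !leq_max leqnn !orbT.
Qed.

End FactorialGraph.

(** * Subdivisions inside the graph *)

Section Subdivision.
Variables (H S : sgraph) (f : H -> S) (P : H -> H -> seq S).
Hypothesis sub : is_subdivision_via f P.
Variable g : S -> fact_graph.
Hypotheses (g_inj : injective g) (g_homo : {homo g : x y / adj x y}).

Definition via (u w v : H) : seq S := P u w ++ f w :: P w v.

Lemma via_path u w v : adj u w -> adj w v ->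
  path (@adj S) (f u) (rcons (via u w v) (f v)).
Proof.
move=> uw wv; have := subdiv_path sub uw; have := subdiv_path sub wv.
rewrite /via rcons_cat rcons_cons -cat_rcons => h1 h2.
by rewrite cat_path h2 last_rcons.
Qed.

Lemma via_end u w v z : adj u w -> adj w v -> z != w -> f z \notin via u w v.
Proof.
move=> uw wv zw; rewrite /via mem_cat inE !negb_or.
by rewrite (inj_eq (branch_inj sub)) zw !(subdiv_branch sub).
Qed.

Lemma via_inner u w v : adj u w -> adj w v ->
  [/\ via u w v != [::], path (@adj S) (f u) (rcons (via u w v) (f v)),
      f u \notin via u w v & f v \notin via u w v].
Proof.
move=> uw wv; split.
- by rewrite /via; case: (P u w).
- exact: via_path.
- by apply: via_end => //; apply: contraTneq uw => ->; rewrite adj_irr.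
- by apply: via_end => //; apply: contraTneq wv => ->; rewrite adj_irr.
Qed.

Lemma subdiv_disjoint a b c d x : adj a b -> adj c d ->
  (c, d) <> (a, b) -> (c, d) <> (b, a) -> x \in P a b -> x \notin P c d.
Proof.
move=> ab cd n1 n2 xab; apply/negP => xcd.
by case: (subdiv_disj sub ab cd xab xcd).
Qed.

(** The edges [uw], [wv], [uw'], [w'v] are four different unordered pairs, so their subdivided paths
    share no inner vertex, and none of these is a branch vertex. *)
Lemma via_disjoint u v w w' x : u != v -> w != w' ->
  adj u w -> adj w v -> adj u w' -> adj w' v ->
  x \in via u w v -> x \notin via u w' v.
Proof.
move=> uv ww uw wv uw' wv' xin.
have ne (a b : H) : @adj H a b -> a <> b by move=> /[swap] ->; rewrite adj_irr.
have [e1 e2 e3 e4] := And4 (ne _ _ uw) (ne _ _ wv) (ne _ _ uw') (ne _ _ wv').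
move/eqP: uv => uv; have /eqP ww1 := ww.
move: xin; rewrite {1}/via mem_cat inE => /or3P[xin|/eqP->|xin]; last 1 first.
- rewrite /via mem_cat inE !negb_or; apply/and3P; split.
  + by apply: subdiv_disjoint xin => // -[]; congruence.
  + by apply: contraTneq xin => ->; exact: (subdiv_branch sub).
  + by apply: subdiv_disjoint xin => // -[]; congruence.
- rewrite /via mem_cat inE !negb_or; apply/and3P; split.
  + by apply: subdiv_disjoint xin => // -[]; congruence.
  + by apply: contraTneq xin => ->; exact: (subdiv_branch sub).
  + by apply: subdiv_disjoint xin => // -[]; congruence.
- exact: via_end.
Qed.

Lemma no_theta_subdivision u v p1 p2 p3 : u != v ->
  (forall p, p \in [:: p1; p2; p3] ->
     [/\ p != [::], path (@adj S) (f u) (rcons p (f v)), f u \notin p & f v \notin p]) ->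
  (forall z, z \in p1 -> z \notin p2) -> (forall z, z \in p1 -> z \notin p3) ->
  (forall z, z \in p2 -> z \notin p3) -> False.
Proof.
move=> uv Hp d12 d13 d23.
have dis p q : (forall z, z \in p -> z \notin q) ->
    forall z, z \in map g p -> z \notin map g q.
  by move=> d z /mapP[t /d tq ->]; rewrite mem_map.
apply: (@no_theta (g (f u)) (g (f v)) (map g p1) (map g p2) (map g p3));
  try exact: dis.
- by rewrite (inj_eq g_inj) (inj_eq (branch_inj sub)).
- move=> _ /(mapP (s := [:: p1; p2; p3]))[p /Hp[p0 pp up vp] ->].
  split; rewrite ?mem_map //; first by case: p p0 {pp up vp}.
  by rewrite -map_rcons; apply: homo_path pp.
Qed.

(** The three paths through the common neighbours would form a theta. *)
Lemma no_three_common_neighbours (u v w1 w2 w3 : H) : u != v -> uniq [:: w1; w2; w3] ->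
  (forall w, w \in [:: w1; w2; w3] -> adj u w && adj w v) -> False.
Proof.
move=> uv uw ad.
have /andP[] := ad w1 (mem_head _ _).
have /andP[] : adj u w2 && adj w2 v by apply: ad; rewrite !inE eqxx orbT.
have /andP[] : adj u w3 && adj w3 v by apply: ad; rewrite !inE eqxx !orbT.
move: uw; rewrite /= !inE negb_or => /and3P[/andP[n12 n13] n23 _] *.
apply: (@no_theta_subdivision u v (via u w1 v) (via u w2 v) (via u w3 v)) => //.
- by move=> _ /(mapP (s := [:: w1; w2; w3]) (f := fun w => via u w v))[w /ad /andP[? ?] ->]; exact: via_inner.
- by move=> z; apply: via_disjoint.
- by move=> z; apply: via_disjoint.
- by move=> z; apply: via_disjoint.
Qed.

(** An inner vertex on the path of [uv] would make it the third path of a theta, beside those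
    through [w1] and [w2]. *)
Lemma unsubdivided_edge (u v w1 w2 : H) : adj u v -> w1 != w2 ->
  adj u w1 -> adj w1 v -> adj u w2 -> adj w2 v -> fact_adj (g (f u)) (g (f v)).
Proof.
move=> uv w12 a1 b1 a2 b2.
have ne (a b : H) : @adj H a b -> a != b by apply: contraTneq => ->; rewrite adj_irr.
suff P0 : P u v = [::].
  by have := subdiv_path sub uv; rewrite P0 /= andbT => /g_homo.
apply/eqP/negPn/negP => P0.
have dis (w : H) x : adj u w -> adj w v -> x \in P u v -> x \notin via u w v.
  move=> a b xin; have [/eqP n1 /eqP n2 /eqP n3] := And3 (ne _ _ a) (ne _ _ b) (ne _ _ uv).
  rewrite /via mem_cat inE !negb_or; apply/and3P; split.
  + by apply: subdiv_disjoint xin => // -[]; congruence.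
  + by apply: contraTneq xin => ->; exact: (subdiv_branch sub).
  + by apply: subdiv_disjoint xin => // -[]; congruence.
apply: (@no_theta_subdivision u v (P u v) (via u w1 v) (via u w2 v)).
- exact: ne.
- move=> p; rewrite !inE => /or3P[] /eqP->; try exact: via_inner.
  split=> //; first exact: (subdiv_path sub).
    exact: (subdiv_branch sub).
  exact: (subdiv_branch sub).
- by move=> z; apply: dis.
- by move=> z; apply: dis.
- by move=> z; apply: via_disjoint => //; apply: ne.
Qed.

End Subdivision.

Theorem theorem3p4 :
  exists G : sgraph,
    infinitely_edge_connected G /\
    ~ topological_minor farey_graph G /\
    ~ topological_minor (cone Taleph0) G.
Proof.
exists fact_graph; split; first exact: fact_graph_infinitely_edge_connected.
split=> -[S [[f [P sub]] [g [g_inj g_homo]]]].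
  have E := @unsubdivided_edge farey_graph S f P sub g g_inj g_homo.
  apply: (@no_triangle (g (f (Some 0))) (g (f (Some 1))) (g (f None))).
  (* For each side of the triangle, one common neighbour is its third vertex; the other is 1/2, 2 or
     -1. *)
  - exact: (E _ _ None (Some (1 / 2%:R))).
  - exact: (E _ _ (Some 0) (Some 2%:R)).
  - exact: (E _ _ (Some 1) (Some (- 1))).
(* The apex and the root of the tree have all children of the root as common neighbours; three of
   them give [K_{2,3}]. *)
apply: (@no_three_common_neighbours (cone Taleph0) S f P sub g g_inj g_homo
  None (Some [::]) (Some [:: 0%N]) (Some [:: 1%N]) (Some [:: 2%N])) => //.
by move=> w; rewrite !inE => /or3P[] /eqP->.
Qed.
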